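(* There exist universal constants $0<C_2<C_1$, $C_3>0$, $c_0>0$ and $K>0$ such that for all probability distributions $p,q$ on a finite set and all $0<\eta\le c_0\,d_{\mathrm{TV}}(p,q)$, $$N_{\mathrm{Transformation}}\!\left(\frac{\eta}{C_1C_3}\right)\le K\,n^\star_{\mathrm{robust}}(\eta)\qquad\text{and}\qquad n^\star_{\mathrm{robust}}(\eta)\le K\,N_{\mathrm{Transformation}}\!\left(\frac{\eta}{C_2}\right).$$
   Context: Fix distributions $p,q$ on a finite set $\mathcal X$; $d_{\mathrm{TV}}(p,q)=\frac12\sum_x|p(x)-q(x)|$. Differential privacy: a randomised algorithm $\mathcal A:\mathcal X^n\to\mathcal Y$ is $\gamma$-DP if $\Pr[\mathcal A(S)\in E]\le e^{\gamma}\Pr[\mathcal A(S')\in E]$ for all events $E\subseteq\mathcal Y$ and all $S,S'\in\mathcal X^n$ differing in at most one observation. The private sample complexity $n^\star_{\mathrm{privacy}}(\gamma)$, $\gamma>0$, is the smallest $n$ such that $\inf_\phi\{\mathbb P_{p^{\otimes n}}(\phi=1)+\mathbb P_{q^{\otimes n}}(\phi=0)\}\le\frac1{10}$, the infimum being over $\gamma$-DP tests $\phi:\mathcal X^n\to\{0,1\}$. Define $\gamma^\star(n)=\min\{\gamma: n^\star_{\mathrm{privacy}}(\gamma)\le n\}$ for $n\in\mathbb N$ ($\infty$ if no such $\gamma$ exists), and, for $\eta>0$, $$N_{\mathrm{Transformation}}(\eta)=\min\{n: n\cdot\gamma^\star(n)\le 1/\eta\}$$ ($\infty$ if no such $n$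 exists). $n^\star_{\mathrm{robust}}(\eta)$ is the sample complexity under strong (adaptive-TV) contamination: with $n$ i.i.d. clean samples, an adversary who sees the whole dataset chooses $\lfloor n\eta\rfloor$ samples and replaces them by arbitrary elements of $\mathcal X$, and the dataset is released after a uniformly random permutation; $n^\star_{\mathrm{robust}}(\eta)$ is the smallest $n$ for which some (possibly randomised) test on the released dataset has worst case type-I error (sup over adversaries, clean samples from $p$, output $1$) plus worst case type-II error (sup over adversaries, clean samples from $q$, output $0$) at most $\frac1{10}$ ($\infty$ if none). *)

(* Defs.v *)
From HB Require Import structures.
From mathcomp Require Import all_boot all_order all_algebra all_fingroup.
From mathcomp Require Import all_classical all_reals all_analysis.

Set Implicit Arguments.
Unset Strict Implicit.
Unset Printing Implicit Defensive.

Import Order.TTheory GRing.Theory Num.Theory.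

Local Open Scope classical_set_scope.
Local Open Scope ring_scope.

Record distr (R : realType) (X : finType) := Distr {
  pmf :> X -> R ;
  pmf_ge0 : forall x, 0 <= pmf x ;
  pmf_sum1 : \sum_x pmf x = 1 }.

Definition dTV (R : realType) (X : finType) (p q : distr R X) : R :=
  2^-1 * \sum_x `|p x - q x|.

Definition Pr (R : realType) (Y : finType) (mu : distr R Y) (E : {set Y}) : R :=
  \sum_(y in E) mu y.

Definition iid (R : realType) (X : finType) (p : distr R X) (n : nat)
    (s : n.-tuple X) : R :=
  \prod_(i < n) p (tnth s i).

Definition hamming (X : finType) (n : nat) (s s' : n.-tuple X) : nat :=
  #|[set i | tnth s i != tnth s' i]%SET|.

(* A randomised algorithm maps each dataset to the law of its output; a
   randomised test has outputs in [bool], [true] standing for 1. *)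
Definition algorithm (R : realType) (X : finType) (n : nat) (Y : finType) :=
  n.-tuple X -> distr R Y.

Definition test (R : realType) (X : finType) (n : nat) :=
  algorithm R X n bool.

Definition is_DP (R : realType) (X : finType) (n : nat) (Y : finType)
    (g : R) (A : algorithm R X n Y) : Prop :=
  forall (E : {set Y}) (s s' : n.-tuple X), (hamming s s' <= 1)%N ->
    Pr (A s) E <= expR g * Pr (A s') E.

(* Least element of a set of natural numbers, [+oo] if the set is empty. *)
Definition least (R : realType) (P : set nat) : \bar R :=
  ereal_inf [set (n%:R)%:E | n in P].

(* Probability that [phi] outputs [b] on [n] i.i.d. samples from [p]. *)
Definition clean_prob (R : realType) (X : finType) (n : nat) (p : distr R X)
    (phi : test R X n) (b : bool) : R :=
  \sum_(s : n.-tuple X) iid p s * Pr (phi s) [set b]%SET.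

Definition DP_error (R : realType) (X : finType) (p q : distr R X) (n : nat)
    (g : R) : \bar R :=
  ereal_inf [set (clean_prob p phi true + clean_prob q phi false)%:E
            | phi in [set phi : test R X n | is_DP g phi]].

Definition n_privacy (R : realType) (X : finType) (p q : distr R X) (g : R) :
    \bar R :=
  least R [set n | (DP_error p q n g <= (10^-1)%:E)%E].

(* The infimum is a minimum whenever the set is nonempty: by compactness of the
   set of tests, and because 0-DP tests are constant and have total error 1. *)
Definition gamma_star (R : realType) (X : finType) (p q : distr R X) (n : nat) :
    \bar R :=
  ereal_inf [set g%:E
            | g in [set g : R | 0 < g /\ (n_privacy p q g <= (n%:R)%:E)%E]].

(* [0 < n] is needed because [gamma_star p q 0 = +oo] and [0 * +oo = 0] in
   [\bar R]: without it the minimum would always be 0. *)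
Definition N_transformation (R : realType) (X : finType) (p q : distr R X)
    (eta : R) : \bar R :=
  least R [set n | (0 < n)%N /\
                   ((n%:R)%:E * gamma_star p q n <= (eta^-1)%:E)%E].

(* An adversary sees the whole clean dataset and outputs a possibly random
   corruption of it. Replacement values are arbitrary, so a replaced entry may
   keep its value: replacing [k] entries means Hamming distance at most [k]. *)
Definition is_adversary (R : realType) (X : finType) (n k : nat)
    (A : algorithm R X n (n.-tuple X)) : Prop :=
  forall s s' : n.-tuple X, 0 < A s s' -> (hamming s s' <= k)%N.

Definition permute (X : finType) (n : nat) (sigma : 'S_n) (s : n.-tuple X) :
    n.-tuple X :=
  [tuple tnth s (sigma i) | i < n].

(* Probability that [phi] outputs [b] on the released dataset: i.i.d. samples
   from [p], corrupted by [A], then permuted uniformly at random. *)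
Definition corrupted_prob (R : realType) (X : finType) (n : nat)
    (p : distr R X) (A : algorithm R X n (n.-tuple X)) (phi : test R X n)
    (b : bool) : R :=
  \sum_(s : n.-tuple X) iid p s *
    \sum_(s' : n.-tuple X) A s s' *
      ((n`!%:R)^-1 * \sum_(sigma : 'S_n) Pr (phi (permute sigma s')) [set b]%SET).

Definition worst_error (R : realType) (X : finType) (n k : nat)
    (p : distr R X) (phi : test R X n) (b : bool) : \bar R :=
  ereal_sup [set (corrupted_prob p A phi b)%:E
            | A in [set A : algorithm R X n (n.-tuple X) | is_adversary k A]].

Definition n_robust (R : realType) (X : finType) (p q : distr R X) (eta : R) :
    \bar R :=
  least R [set n | exists phi : test R X n,
    (worst_error (Num.truncn (n%:R * eta)) p phi true +
     worst_error (Num.truncn (n%:R * eta)) q phi false <= (10^-1)%:E)%E].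

(* Main.v *)
(* A private test is robust by group privacy: [k] replacements change its output
   probabilities by a factor at most [exp (g * k)]. Conversely, if a robust test
   outputs [b] with (permutation-averaged) probability [psi_b s], let [F_b s] be
   the maximum over all datasets [u] of [psi_b u * exp (- g / 2 * hamming s u)].
   Then [log F_b] is [g/2]-Lipschitz, so outputting [b] with probability
   [F_b / (F_true + F_false)] is [g]-DP. As [F_true + F_false >= 1], the error is
   at most the maximum of [psi_b] over the ball of radius [k], which an adversary
   attains, plus [exp (- g / 2 * (k + 1))]. In both directions a majority vote
   over three blocks of data preserves [g]-DP and absorbs the constants. *)
Require Import Defs.
From mathcomp Require Import all_boot all_order all_algebra all_fingroup.
From mathcomp Require Import all_classical all_reals all_analysis.
From mathcomp Require Import zify ring lra.

Set Implicit Arguments.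
Unset Strict Implicit.
Unset Printing Implicit Defensive.

Import Order.TTheory GRing.Theory Num.Theory.
Local Open Scope ring_scope.

(** * Hamming distance on datasets, and splitting a dataset into blocks *)

Lemma hammingC (X : finType) n (s t : n.-tuple X) : hamming s t = hamming t s.
Proof. by apply: eq_card => i; rewrite !inE eq_sym. Qed.

Lemma hamming_triangle (X : finType) n (t s u : n.-tuple X) :
  (hamming s u <= hamming s t + hamming t u)%N.
Proof.
rewrite /hamming; apply: leq_trans (leq_card_setU _ _).
apply/subset_leq_card/fintype.subsetP => i; rewrite !inE -negb_and.
by apply: contra => /andP[/eqP -> /eqP ->].
Qed.

Lemma hammingss (X : finType) n (s : n.-tuple X) : hamming s s = 0%N.
Proof. by apply: eq_card0 => i; rewrite !inE eqxx. Qed.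

Lemma hamming0_eq (X : finType) n (s t : n.-tuple X) :
  (hamming s t <= 0)%N -> s = t.
Proof.
rewrite leqn0 finset.cards_eq0 => /eqP st; apply: eq_from_tnth => i.
by apply/eqP/negP => /negP h; have := finset.in_set0 i; rewrite -st inE h.
Qed.

Lemma hamming_cat (X : finType) m n (s s' : m.-tuple X) (t t' : n.-tuple X) :
  hamming (cat_tuple s t) (cat_tuple s' t') = (hamming s s' + hamming t t')%N.
Proof.
rewrite /hamming -!sum1dep_card big_split_ord /=.
by congr addn; apply: eq_bigl => i; rewrite ?tnth_lshift ?tnth_rshift.
Qed.

Lemma hamming_permute (X : finType) n (sg : 'S_n) (s t : n.-tuple X) :
  hamming (permute sg s) (permute sg t) = hamming s t.
Proof.
rewrite /hamming -!sum1dep_card [RHS](reindex_perm sg) /=.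
by apply: eq_bigl => i; rewrite !tnth_mktuple.
Qed.

Definition lpart (X : finType) m n (u : (m + n).-tuple X) : m.-tuple X :=
  [tuple tnth u (lshift n i) | i < m].

Definition rpart (X : finType) m n (u : (m + n).-tuple X) : n.-tuple X :=
  [tuple tnth u (rshift m i) | i < n].

Lemma lpart_cat (X : finType) m n (s : m.-tuple X) (t : n.-tuple X) :
  lpart (cat_tuple s t) = s.
Proof. by apply: eq_from_tnth => i; rewrite tnth_mktuple tnth_lshift. Qed.

Lemma rpart_cat (X : finType) m n (s : m.-tuple X) (t : n.-tuple X) :
  rpart (cat_tuple s t) = t.
Proof. by apply: eq_from_tnth => i; rewrite tnth_mktuple tnth_rshift. Qed.

Lemma cat_parts (X : finType) m n (u : (m + n).-tuple X) :
  cat_tuple (lpart u) (rpart u) = u.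
Proof.
apply: eq_from_tnth => i; case: (split_ordP i) => j ->.
  by rewrite tnth_lshift tnth_mktuple.
by rewrite tnth_rshift tnth_mktuple.
Qed.

Lemma hamming_parts (X : finType) m n (u u' : (m + n).-tuple X) :
  hamming u u' = (hamming (lpart u) (lpart u') + hamming (rpart u) (rpart u'))%N.
Proof. by rewrite -hamming_cat !cat_parts. Qed.

(** Overwriting one coordinate of [s] where it disagrees with [u] by the entry of [u] gives [t].
    This is the inductive step of group privacy. *)
Lemma hamming_step (X : finType) n k (s u : n.-tuple X) :
  (hamming s u <= k.+1)%N ->
  exists2 t, (hamming s t <= 1)%N & (hamming t u <= k)%N.
Proof.
case: (posnP (hamming s u)) => [h _|].
  by exists s; rewrite ?hammingss // h.
rewrite card_gt0 => /set0Pn[i]; rewrite inE => si.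
rewrite {1}/hamming (cardsD1 i) inE si add1n ltnS => hk.
exists [tuple if j == i then tnth u j else tnth s j | j < n].
- rewrite /hamming -[leqRHS](cards1 i); apply/subset_leq_card.
  apply/fintype.subsetP => j; rewrite !inE tnth_mktuple; case: ifP => //.
  by rewrite eqxx.
- apply: leq_trans hk; apply/subset_leq_card.
  apply/fintype.subsetP => j; rewrite !inE tnth_mktuple; case: ifP => //.
  by rewrite eqxx.
Qed.

(** * Elementary finite distributions *)

Section Distributions.
Variables (R : realType).

Lemma Pr_set1 (Y : finType) (mu : distr R Y) y : Pr mu [set y]%SET = mu y.
Proof. by rewrite /Pr big_set1. Qed.

Lemma distr_bool (mu : distr R bool) : mu true + mu false = 1.
Proof. by rewrite -(pmf_sum1 mu) big_bool. Qed.

Definition point_mass (Y : finType) (y : Y) : distr R Y.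
Proof.
refine (@Distr R Y (fun z => (z == y)%:R) (fun z => ler0n _ _) _).
by rewrite (bigD1 y) //= eqxx big1 ?addr0 // => z /negbTE ->.
Defined.

Lemma sum_point_mass (Y : finType) (y : Y) (f : Y -> R) :
  \sum_z point_mass y z * f z = f y.
Proof.
rewrite (bigD1 y) //= eqxx mul1r big1 ?addr0 // => z /negbTE ->.
exact: mul0r.
Qed.

Definition coin (h : R) (h01 : 0 <= h <= 1) : distr R bool.
Proof.
refine (@Distr R bool (fun b => if b then h else 1 - h) _ _).
- by case; [case/andP: h01 | rewrite subr_ge0; case/andP: h01].
- by rewrite big_bool /= addrC subrK.
Defined.

End Distributions.

(** * Expectation under i.i.d. sampling *)

Section Expectation.
Variables (R : realType) (X : finType).
Implicit Types p : distr R X.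

Definition expect p n (f : n.-tuple X -> R) : R := \sum_s iid p s * f s.

Lemma iid_ge0 p n (s : n.-tuple X) : 0 <= iid p s.
Proof. by apply: prodr_ge0 => i _; exact: Defs.pmf_ge0. Qed.

Lemma ler_expect p n (f g : n.-tuple X -> R) :
  (forall s, f s <= g s) -> expect p f <= expect p g.
Proof. by move=> fg; apply: ler_sum => s _; rewrite ler_wpM2l ?iid_ge0. Qed.

Lemma eq_expect p n (f g : n.-tuple X -> R) :
  f =1 g -> expect p f = expect p g.
Proof. by move=> fg; apply: eq_bigr => s _; rewrite fg. Qed.

Lemma expectD p n (f g : n.-tuple X -> R) :
  expect p (fun s => f s + g s) = expect p f + expect p g.
Proof. by rewrite /expect -big_split; apply: eq_bigr => s _; rewrite mulrDr. Qed.

Lemma expectZ p n c (f : n.-tuple X -> R) :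
  expect p (fun s => c * f s) = c * expect p f.
Proof. by rewrite /expect mulr_sumr; apply: eq_bigr => s _; rewrite mulrCA. Qed.

Lemma iid_cat p m n (s : m.-tuple X) (t : n.-tuple X) :
  iid p (cat_tuple s t) = iid p s * iid p t.
Proof.
rewrite /iid big_split_ord /=.
by congr (_ * _); apply: eq_bigr => i _; rewrite ?tnth_lshift ?tnth_rshift.
Qed.

(** Independence of disjoint blocks: the i.i.d. weight of a concatenation is a product, so the sum
    iterates. *)
Lemma expect_cat p m n (f : (m + n).-tuple X -> R) :
  expect p f = expect p (fun s => expect p (fun t => f (cat_tuple s t))).
Proof.
rewrite /expect.
rewrite (reindex (fun u : m.-tuple X * n.-tuple X => cat_tuple u.1 u.2)) /=.
  under [RHS]eq_bigr do rewrite mulr_sumr.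
  rewrite pair_bigA; apply: eq_bigr => -[s t] _ /=.
  by rewrite iid_cat mulrA.
apply: onW_bij.
by exists (fun u => (lpart u, rpart u)) => [[s t]|u] /=;
  rewrite ?lpart_cat ?rpart_cat ?cat_parts.
Qed.

Lemma iid_sum1 p n : \sum_(s : n.-tuple X) iid p s = 1.
Proof.
rewrite (reindex (fun f : {ffun 'I_n -> X} => [tuple f i | i < n])) /=.
  transitivity (\prod_(i < n) \sum_x p x).
    rewrite bigA_distr_bigA; apply: eq_bigr => f _.
    by apply: eq_bigr => i _; rewrite tnth_mktuple.
  by apply: big1 => i _; exact: pmf_sum1.
apply: onW_bij; exists (fun s => [ffun i => tnth s i]) => [f|s].
  by apply/ffunP => i; rewrite ffunE tnth_mktuple.
by apply: eq_from_tnth => i; rewrite tnth_mktuple ffunE.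
Qed.

Lemma expect_cst p n c : expect p (fun _ : n.-tuple X => c) = c.
Proof. by rewrite /expect -mulr_suml iid_sum1 mul1r. Qed.

(** I.i.d. samples are exchangeable, so shuffling a clean dataset does not change its law. *)
Lemma expect_permute p n (sg : 'S_n) (f : n.-tuple X -> R) :
  expect p (fun s => f (permute sg s)) = expect p f.
Proof.
rewrite /expect [RHS](reindex (fun s : n.-tuple X => permute sg s)) /=.
  apply: eq_bigr => s _; congr (_ * _).
  rewrite /iid (reindex_perm sg).
  by apply: eq_bigr => i _; rewrite tnth_mktuple.
apply: onW_bij; exists (permute sg^-1%g) => s;
  by apply: eq_from_tnth => i; rewrite !tnth_mktuple ?permK ?permKV.
Qed.

Lemma clean_probE p n (phi : test R X n) b :
  clean_prob p phi b = expect p (fun s => phi s b).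
Proof. by apply: eq_bigr => s _; rewrite Pr_set1. Qed.

Lemma clean_prob_ge0 p n (phi : test R X n) b : 0 <= clean_prob p phi b.
Proof.
by rewrite clean_probE; apply: sumr_ge0 => s _; rewrite mulr_ge0 ?iid_ge0 ?Defs.pmf_ge0.
Qed.

Lemma clean_prob_total p n (phi : test R X n) :
  clean_prob p phi true + clean_prob p phi false = 1.
Proof.
rewrite !clean_probE -expectD (@eq_expect _ _ _ (fun=> 1)) ?expect_cst //.
by move=> s; exact: distr_bool.
Qed.

End Expectation.

(** * Majority vote of three independent events *)

Section Majority.
Variable R : realType.
Implicit Types a b c G : R.

(* The probability that at least two of three independent events of
   probabilities [a], [b], [c] occur. *)
Definition majority a b c := a * b + b * c + c * a - 2 * (a * b * c).

(** Conditions on the first vote. The coefficients of [a] and [1 - a] are nonnegative when the other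
    two are probabilities, which gives both positivity and the privacy bound. *)
Lemma majorityE a b c :
  majority a b c = a * (b * (1 - c) + c) + (1 - a) * (b * c).
Proof. by rewrite /majority; ring. Qed.

Lemma majorityC a b c : majority a b c = majority b a c.
Proof. by rewrite /majority; ring. Qed.

Lemma majority_rot a b c : majority a b c = majority c a b.
Proof. by rewrite /majority; ring. Qed.

Lemma majority_compl a b c :
  1 - majority a b c = majority (1 - a) (1 - b) (1 - c).
Proof. by rewrite /majority; ring. Qed.

Lemma majority_ge0 a b c :
  0 <= a <= 1 -> 0 <= b <= 1 -> 0 <= c <= 1 -> 0 <= majority a b c.
Proof.
move=> /andP[a0 a1] /andP[b0 b1] /andP[c0 c1].
by rewrite majorityE; apply: addr_ge0;
  rewrite mulr_ge0 ?subr_ge0 ?addr_ge0 ?mulr_ge0 ?subr_ge0.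
Qed.

Lemma compl01 a : 0 <= a <= 1 -> 0 <= 1 - a <= 1.
Proof. by move=> /andP[a0 a1]; rewrite subr_ge0 a1 gerBl a0. Qed.

Lemma majority01 a b c :
  0 <= a <= 1 -> 0 <= b <= 1 -> 0 <= c <= 1 -> 0 <= majority a b c <= 1.
Proof.
move=> a01 b01 c01; rewrite majority_ge0 //= -subr_ge0 majority_compl.
by rewrite majority_ge0 ?compl01.
Qed.

(** With two votes fixed, the majority is a nonnegative combination of the third vote and its
    complement, so a multiplicative bound on both outcomes survives the vote. *)
Lemma ler_majority G a a' b c : 0 <= b <= 1 -> 0 <= c <= 1 ->
  a <= G * a' -> 1 - a <= G * (1 - a') ->
  majority a b c <= G * majority a' b c.
Proof.
move=> /andP[b0 b1] /andP[c0 c1] aa' aa'C.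
by rewrite !majorityE [leRHS]mulrDr; apply: lerD; rewrite [leRHS]mulrA ler_wpM2r //;
  rewrite ?subr_ge0 ?addr_ge0 ?mulr_ge0 ?subr_ge0.
Qed.

Lemma majority_diag_le a : 0 <= a -> majority a a a <= 3 * a ^+ 2.
Proof.
move=> a0; have : 0 <= a * (a * a) by rewrite !mulr_ge0.
by rewrite /majority; lra.
Qed.

End Majority.

(** * Group privacy and error reduction for private tests *)

Section Privacy.
Variables (R : realType) (X : finType).
Implicit Types p q : distr R X.

Lemma is_DP_test n g (phi : test R X n) :
  (forall b s s', (hamming s s' <= 1)%N -> phi s b <= expR g * phi s' b) ->
  is_DP g phi.
Proof.
by move=> dp E s s' ss'; rewrite /Pr mulr_sumr; apply: ler_sum => b _; exact: dp.
Qed.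

Lemma is_DP_pmf n (Y : finType) g (A : algorithm R X n Y) y s s' :
  is_DP g A -> (hamming s s' <= 1)%N -> A s y <= expR g * A s' y.
Proof. by move=> dp ss'; have := dp [set y]%SET _ _ ss'; rewrite !Pr_set1. Qed.

Lemma group_privacy n (Y : finType) g (A : algorithm R X n Y) k y s s' :
  0 <= g -> is_DP g A -> (hamming s s' <= k)%N ->
  A s y <= expR (g * k%:R) * A s' y.
Proof.
move=> g0 dp; elim: k s s' => [|k IHk] s s'.
  by move=> /hamming0_eq ->; rewrite mulr0 expR0 mul1r.
move=> /hamming_step[t st ts'].
apply: le_trans (is_DP_pmf y dp st) _.
rewrite -natr1 mulrDr mulr1 addrC expRD -mulrA ler_wpM2l ?expR_ge0 //.
exact: IHk.
Qed.

Lemma distr_bool01 (mu : distr R bool) b : 0 <= mu b <= 1.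
Proof.
rewrite Defs.pmf_ge0 -(distr_bool mu).
by case: b; rewrite ?lerDl ?lerDr Defs.pmf_ge0.
Qed.

Lemma distr_boolN (mu : distr R bool) b : 1 - mu b = mu (~~ b).
Proof. by rewrite -(distr_bool mu); case: b => /=; ring. Qed.

(** The majority is affine in each argument and the blocks are independent, so the expectation
    enters one argument at a time. *)
Lemma expect_majority p n (f : n.-tuple X -> R) :
  expect p (fun u : (n + (n + n)).-tuple X =>
    majority (f (lpart u)) (f (lpart (rpart u))) (f (rpart (rpart u)))) =
  majority (expect p f) (expect p f) (expect p f).
Proof.
have affine a b : expect p (fun s => majority a b (f s)) =
    majority a b (expect p f).
  rewrite (@eq_expect _ _ _ _ _ (fun s => a * b + (b + a - 2 * (a * b)) * f s)).
    by rewrite expectD expect_cst expectZ /majority; ring.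
  by move=> s; rewrite /majority; ring.
rewrite expect_cat.
transitivity (expect p (fun s => majority (expect p f) (expect p f) (f s))).
  apply: eq_expect => s; rewrite expect_cat [RHS]majority_rot -affine.
  apply: eq_expect => t; rewrite [RHS]majority_rot [RHS]majorityC -affine.
  apply: eq_expect => u.
  by rewrite !(lpart_cat, rpart_cat).
exact: affine.
Qed.

(** Voting over disjoint blocks costs no privacy, since one changed observation alters only one
    vote. A wrong majority needs two wrong votes, so each error is essentially squared. *)
Lemma majority_test n g (phi : test R X n) : is_DP g phi ->
  exists2 psi : test R X (n + (n + n)), is_DP g psi &
    forall p b, clean_prob p psi b <= 3 * clean_prob p phi b ^+ 2.
Proof.
move=> dp; pose vote b (u : (n + (n + n)).-tuple X) :=
  majority (phi (lpart u) b) (phi (lpart (rpart u)) b) (phi (rpart (rpart u)) b).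
have vote01 u : 0 <= vote true u <= 1 by apply: majority01; exact: distr_bool01.
pose psi : test R X (n + (n + n)) := fun u => coin (vote01 u).
have psiE u b : psi u b = vote b u.
  by case: b => //=; rewrite /vote majority_compl !distr_boolN.
exists psi => [|p b].
  apply: is_DP_test => b u u'; rewrite !psiE !hamming_parts /vote.
  set h1 := hamming _ _; set h2 := hamming _ _; set h3 := hamming _ _ => h.
  have step b' s s' : (hamming s s' <= 1)%N -> phi s b' <= expR g * phi s' b'.
    exact: is_DP_pmf.
  (* The three block distances sum to at most 1. The cases locate the block that may change, and the
     symmetries of the majority bring its vote to the first argument. *)
  have [/eqP h1_0|h1_1] := eqVneq h1 0%N; last first.
    have /andP[h2_0 h3_0] : (h2 <= 0)%N && (h3 <= 0)%N by lia.
    rewrite (hamming0_eq h2_0) (hamming0_eq h3_0).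
    by apply: ler_majority; rewrite ?distr_bool01 ?distr_boolN ?step //; lia.
  rewrite (hamming0_eq (_ : h1 <= 0)%N) ?leqn0 //.
  have [/eqP h2_0|h2_1] := eqVneq h2 0%N; last first.
    have h3_0 : (h3 <= 0)%N by lia.
    rewrite (hamming0_eq h3_0) majorityC [majority _ _ _ in leRHS]majorityC.
    by apply: ler_majority; rewrite ?distr_bool01 ?distr_boolN ?step //; lia.
  rewrite (hamming0_eq (_ : h2 <= 0)%N) ?leqn0 //.
  rewrite majority_rot [majority _ _ _ in leRHS]majority_rot.
  by apply: ler_majority; rewrite ?distr_bool01 ?distr_boolN ?step //; lia.
rewrite clean_probE (eq_expect _ (fun u => psiE u b)) /vote.
rewrite (expect_majority p (fun s => phi s b)).
by rewrite -clean_probE majority_diag_le ?clean_prob_ge0.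
Qed.

End Privacy.

(** * Tests under contamination, and private tests built from robust ones *)

Section Robustness.
Variables (R : realType) (X : finType).
Implicit Types p q : distr R X.

Definition shuffled n (phi : test R X n) (b : bool) (s : n.-tuple X) : R :=
  (n`!%:R)^-1 * \sum_(sigma : 'S_n) phi (permute sigma s) b.

Lemma corrupted_probE p n (A : algorithm R X n (n.-tuple X)) phi b :
  corrupted_prob p A phi b =
  expect p (fun s => \sum_s' A s s' * shuffled phi b s').
Proof.
apply: eq_bigr => s _; congr (_ * _); apply: eq_bigr => s' _.
by congr (_ * (_ * _)); apply: eq_bigr => sg _; rewrite Pr_set1.
Qed.

Lemma sum_perm_cst n (c : R) : (n`!%:R)^-1 * \sum_(sigma : 'S_n) c = c.
Proof.
rewrite sumr_const card_Sn -[c *+ _]mulr_natl mulKf //.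
Qed.

Lemma shuffled_ge0 n (phi : test R X n) b s : 0 <= shuffled phi b s.
Proof.
by rewrite mulr_ge0 ?invr_ge0 ?ler0n ?sumr_ge0 // => sg _; exact: Defs.pmf_ge0.
Qed.

Lemma shuffled_total n (phi : test R X n) s :
  shuffled phi true s + shuffled phi false s = 1.
Proof.
rewrite -mulrDr -big_split /= -[RHS](@sum_perm_cst n); congr (_ * _).
by apply: eq_bigr => sg _; exact: distr_bool.
Qed.

Lemma shuffled_le1 n (phi : test R X n) b s : shuffled phi b s <= 1.
Proof.
by rewrite -(shuffled_total phi s); case: b; rewrite ?lerDl ?lerDr shuffled_ge0.
Qed.

Lemma expect_shuffled p n (phi : test R X n) b :
  expect p (shuffled phi b) = clean_prob p phi b.
Proof.
rewrite clean_probE /shuffled expectZ -[RHS](@sum_perm_cst n); congr (_ * _).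
rewrite /expect; under eq_bigr do rewrite mulr_sumr.
rewrite exchange_big; apply: eq_bigr => sg _ /=.
exact: (expect_permute p sg (fun s => phi s b)).
Qed.

(** Applying the same permutation to the clean and the corrupted data keeps their distance, so group
    privacy applies for each permutation. Exchangeability then removes the shuffle from the clean
    side. *)
Lemma corrupted_prob_DP p n k g (A : algorithm R X n (n.-tuple X)) phi b :
  0 <= g -> is_DP g phi -> is_adversary k A ->
  corrupted_prob p A phi b <= expR (g * k%:R) * clean_prob p phi b.
Proof.
move=> g0 dp advA; rewrite corrupted_probE -expect_shuffled -expectZ.
apply: ler_expect => s.
rewrite -[leRHS]mul1r -[X in _ <= X * _](pmf_sum1 (A s)) mulr_suml.
apply: ler_sum => s' _.
(* The distance bound holds only for corruptions of positive probability; the other terms vanish. *)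
have [->|As'] := eqVneq (A s s') 0; first by rewrite !mul0r.
rewrite ler_wpM2l ?Defs.pmf_ge0 // /shuffled mulrCA ler_wpM2l ?invr_ge0 ?ler0n //.
rewrite mulr_sumr; apply: ler_sum => sg _; apply: (group_privacy b g0 dp).
by rewrite hamming_permute hammingC advA // lt0r As' Defs.pmf_ge0.
Qed.

Lemma worst_error_DP p n k g (phi : test R X n) b :
  0 <= g -> is_DP g phi ->
  (worst_error k p phi b <= (expR (g * k%:R) * clean_prob p phi b)%:E)%E.
Proof.
move=> g0 dp; apply: ge_ereal_sup => _ [A advA <-].
by rewrite lee_fin corrupted_prob_DP.
Qed.

(** For [g >= 0] and nonnegative [w], the least majorant of [w] whose value changes by a factor at
    most [expR g] between neighbouring datasets: a multiplicative Lipschitz envelope. *)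
Definition soft_max n (g : R) (w : n.-tuple X -> R) (s : n.-tuple X) : R :=
  \big[Num.max/0]_u (w u * expR (- (g * (hamming s u)%:R))).

Lemma soft_max_ge0 n g w (s : n.-tuple X) : 0 <= soft_max g w s.
Proof. exact: bigmax_ge_id. Qed.

Lemma ge_soft_max n g w (s : n.-tuple X) : w s <= soft_max g w s.
Proof.
apply: le_trans (le_bigmax _ _ s).
by rewrite hammingss mulr0 oppr0 expR0 mulr1.
Qed.

Lemma soft_max_lip n g w (s s' : n.-tuple X) : 0 <= g -> (forall u, 0 <= w u) ->
  (hamming s s' <= 1)%N -> soft_max g w s <= expR g * soft_max g w s'.
Proof.
move=> g0 w0 ss'; apply: bigmax_le => [|u _].
  by rewrite mulr_ge0 ?expR_ge0 ?soft_max_ge0.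
apply: (@le_trans _ _ (expR g * (w u * expR (- (g * (hamming s' u)%:R))))).
  rewrite mulrCA ler_wpM2l // -expRD ler_expR.
  have : g * (hamming s' u)%:R <= g * (1 + hamming s u)%:R.
    rewrite ler_wpM2l // ler_nat (leq_trans (hamming_triangle s _ _)) //.
    by rewrite hammingC leq_add2r.
  by rewrite natrD mulrDr mulr1; lra.
by rewrite ler_wpM2l ?expR_ge0 // le_bigmax.
Qed.

(** Inside the ball of radius [k] the penalty is at most 1 and [w] is at most [w (f s)]. Outside it
    [w] is at most 1 and the distance is at least [k.+1]. *)
Lemma soft_max_le n g k w (f : n.-tuple X -> n.-tuple X) s :
  0 <= g -> (forall u, 0 <= w u <= 1) ->
  (forall u, (hamming s u <= k)%N -> w u <= w (f s)) ->
  soft_max g w s <= w (f s) + expR (- (g * k.+1%:R)).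
Proof.
move=> g0 w01 fP; apply: bigmax_le => [|u _].
  by have /andP[? _] := w01 (f s); rewrite addr_ge0 ?expR_ge0.
have /andP[wu0 wu1] := w01 u; have /andP[wf0 _] := w01 (f s).
have [suk|suk] := leqP (hamming s u) k.
  rewrite ler_wpDr ?expR_ge0 //; apply: le_trans (fP _ suk).
  by rewrite ler_piMr // -expR0 ler_expR oppr_le0 mulr_ge0 ?ler0n.
rewrite ler_wpDl // -[leRHS]mul1r ler_pM ?expR_ge0 //.
by rewrite ler_expR lerN2 ler_wpM2l // ler_nat.
Qed.

Lemma private_of_robust n k g (phi : test R X n) : 0 <= g ->
  exists2 psi : test R X n, is_DP g psi &
    forall p b, exists2 A : algorithm R X n (n.-tuple X), is_adversary k A &
      clean_prob p psi b <=
      corrupted_prob p A phi b + expR (- (g / 2 * k.+1%:R)).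
Proof.
move=> g0; pose F b := soft_max (g / 2) (shuffled phi b).
have g20 : 0 <= g / 2 by rewrite divr_ge0.
have F0 b s : 0 <= F b s by exact: soft_max_ge0.
have F1 s : 1 <= F true s + F false s.
  by rewrite -(shuffled_total phi s) lerD ?ge_soft_max.
have Fpos s : 0 < F true s + F false s by apply: lt_le_trans (F1 s).
have h01 s : 0 <= F true s / (F true s + F false s) <= 1.
  by rewrite divr_ge0 ?addr_ge0 //= ler_pdivrMr // mul1r lerDl.
pose psi : test R X n := fun s => coin (h01 s).
have psiE s b : psi s b = F b s / (F true s + F false s).
  case: b => //=; rewrite -[X in X - _](divff (lt0r_neq0 (Fpos s))) -mulrBl.
  by rewrite addrC addKr.
exists psi => [|p b].
  apply: is_DP_test => b s s' ss'; rewrite !psiE.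
  have Flip b' t t' : (hamming t t' <= 1)%N -> F b' t <= expR (g / 2) * F b' t'.
    by apply: soft_max_lip => // u; exact: shuffled_ge0.
  (* Numerator and normaliser each vary by a factor at most [expR (g / 2)], so their ratio uses the
     full budget [g]. *)
  have Dlip : F true s' + F false s' <= expR (g / 2) * (F true s + F false s).
    by rewrite mulrDr lerD // Flip // hammingC.
  rewrite ler_pdivrMr //; apply: le_trans (Flip b _ _ ss') _.
  have q0 : 0 <= F b s' / (F true s' + F false s').
    by apply: divr_ge0 => //; exact: ltW.
  rewrite -{1}(divfK (lt0r_neq0 (Fpos s')) (F b s')).
  rewrite [g in leRHS]splitr expRD -[leRHS]mulrA -[leRHS]mulrA ler_wpM2l ?expR_ge0 //.
  by rewrite [leRHS]mulrCA ler_wpM2l.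
(* The deterministic adversary that moves to a worst dataset in the ball of radius [k]. *)
pose f (s : n.-tuple X) :=
  [arg max_(u > s | (hamming s u <= k)%N) shuffled phi b u]%O.
have fP s : (hamming s (f s) <= k)%N /\
    forall u, (hamming s u <= k)%N -> shuffled phi b u <= shuffled phi b (f s).
  by rewrite /f; case: arg_maxP => [|u uk umax]; rewrite ?hammingss.
exists (fun s => point_mass R (f s)) => [s s' /=|].
  by have [-> _|_] := eqVneq s' (f s); [case: (fP s) | rewrite ltxx].
rewrite clean_probE corrupted_probE -[X in _ <= _ + X](expect_cst p n) -expectD.
apply: ler_expect => s; rewrite psiE sum_point_mass.
(* The normaliser is at least 1, so dividing by it only lowers [F b s]. *)
apply: (@le_trans _ _ (F b s)).
  by rewrite ler_pdivrMr // ler_peMr.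
apply: soft_max_le => // [u|].
  by rewrite shuffled_ge0 shuffled_le1.
by case: (fP s).
Qed.

Lemma worst_error_ge p n k phi b (A : algorithm R X n (n.-tuple X)) :
  is_adversary k A ->
  ((corrupted_prob p A phi b)%:E <= worst_error k p phi b)%E.
Proof. by move=> advA; apply: ereal_sup_ubound; exists A. Qed.

End Robustness.

(** * Least elements as extended reals *)

Section Least.
Variable R : realType.

Lemma least_le (P : set nat) n : P n -> (least R P <= n%:R%:E)%E.
Proof. by move=> Pn; apply: ereal_inf_lbound; exists n. Qed.

Lemma least_leP (P : set nat) n :
  (least R P <= n%:R%:E)%E -> exists2 m, P m & (m <= n)%N.
Proof.
(* An infimum yields a witness only below a strict bound; for integers, [n.+1] serves. *)
move=> Pn; have : (least R P < n.+1%:R%:E)%E.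
  by apply: le_lt_trans Pn _; rewrite lte_fin ltr_nat.
by case/ereal_inf_lt => _ [m Pm <-]; rewrite lte_fin ltr_nat ltnS; exists m.
Qed.

Lemma least_le_mul (K : R) (P Q : set nat) : 0 < K ->
  (forall n, Q n -> exists2 m, P m & m%:R <= K * n%:R) ->
  (least R P <= K%:E * least R Q)%E.
Proof.
move=> K0 PQ; rewrite -lee_pdivrMl //; apply: le_ereal_inf_tmp => _ [n Qn <-].
rewrite lee_pdivrMl // -EFinM; have [m Pm mn] := PQ n Qn.
by apply: le_trans (least_le Pm) _; rewrite lee_fin.
Qed.

End Least.

(** * Comparison of the two sample complexities *)

Section Comparison.
Variables (R : realType) (X : finType).
Implicit Types p q : distr R X.

Lemma clean_prob_n0 p q (phi : test R X 0) b :
  clean_prob p phi b = clean_prob q phi b.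
Proof. by apply: eq_bigr => s _; rewrite /iid !big_ord0. Qed.

Lemma DP_error_le p q n g (phi : test R X n) : is_DP g phi ->
  (DP_error p q n g <= (clean_prob p phi true + clean_prob q phi false)%:E)%E.
Proof. by move=> dp; apply: ereal_inf_lbound; exists phi. Qed.

Lemma gamma_star_le p q n g (phi : test R X n) : 0 < g -> is_DP g phi ->
  clean_prob p phi true + clean_prob q phi false <= 10^-1 ->
  (gamma_star p q n <= g%:E)%E.
Proof.
move=> g0 dp err; apply: ereal_inf_lbound; exists g => //; split=> //.
by apply: least_le; apply: le_trans (DP_error_le p q dp) _; rewrite lee_fin.
Qed.

(** Rests on [a ^+ 2 + b ^+ 2 <= (a + b) ^+ 2] for the two nonnegative errors. *)
Lemma majority_test_error p q n g (e : R) (phi : test R X n) : is_DP g phi ->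
  clean_prob p phi true + clean_prob q phi false <= e ->
  exists2 psi : test R X (n + (n + n)), is_DP g psi &
    clean_prob p psi true + clean_prob q psi false <= 3 * e ^+ 2.
Proof.
move=> dp err; have [psi dpsi psiP] := majority_test dp; exists psi => //.
apply: le_trans (lerD (psiP _ _) (psiP _ _)) _; rewrite -mulrDr ler_wpM2l //.
have a0 := clean_prob_ge0 p phi true; have b0 := clean_prob_ge0 q phi false.
apply: le_trans (_ : (clean_prob p phi true + clean_prob q phi false) ^+ 2 <= _).
  by rewrite sqrrD lerD2r lerDl mulrn_wge0 ?mulr_ge0.
by rewrite lerXn2r ?nnegrE ?(le_trans _ err) ?addr_ge0.
Qed.

Lemma robust_to_private p q n k g (phi : test R X n) : 58 <= g * k.+1%:R ->
  (worst_error k p phi true + worst_error k q phi false <= (10^-1)%:E)%E ->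
  exists2 psi : test R X (n + (n + n)), is_DP g psi &
    clean_prob p psi true + clean_prob q psi false <= 10^-1.
Proof.
move=> gk err; have g0 : 0 <= g.
  by rewrite -(pmulr_lge0 _ (ltr0Sn R k)) (le_trans _ gk).
have [psi dp psiP] := private_of_robust k phi g0.
(* Here [g / 2 * k.+1%:R] is at least 29, and [expR 29 >= 1 + 29]. *)
have delta : expR (- (g / 2 * k.+1%:R)) <= 30^-1.
  rewrite expRN lef_pV2 ?posrE ?expR_gt0 //.
  by apply: le_trans (expR_ge1Dx _); rewrite mulrAC; lra.
(* The two errors sum to at most 1/10 + 2/30 = 1/6, and the vote brings this to 3/36 = 1/12. *)
suff e6 : clean_prob p psi true + clean_prob q psi false <= 6^-1.
  have [psi3 dp3 err3] := majority_test_error dp e6; exists psi3 => //.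
  by apply: le_trans err3 _; lra.
have [A advA pA] := psiP p true; have [B advB qB] := psiP q false.
have : corrupted_prob p A phi true + corrupted_prob q B phi false <= 10^-1.
  rewrite -lee_fin EFinD; apply: le_trans err.
  by apply: leeD; apply: worst_error_ge.
by lra.
Qed.

Lemma N_transformation_le_robust p q eta : 0 < eta ->
  (N_transformation p q (eta / 174) <= 3%:E * n_robust p q eta)%E.
Proof.
move=> eta0; apply: least_le_mul => // n [phi err].
(* [N_transformation] ranges over positive sizes. With no data the laws under [p] and [q] coincide,
   so the total error would be 1. *)
have n_gt0 : (0 < n)%N.
  case: n phi err => // phi err.
  have [|psi _] := robust_to_private (g := 58) _ err.
    by rewrite ler_peMr ?ler1n.
  by rewrite (clean_prob_n0 q p) clean_prob_total; lra.
exists (n + (n + n))%N; last by rewrite !natrD; lra.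
have n0 : 0 < n%:R :> R by rewrite ltr0n.
have ne0 : 0 < n%:R * eta by rewrite mulr_gt0.
(* The truncation [k] of [n%:R * eta] satisfies [k + 1 > n%:R * eta], so this [g] meets the
   threshold 58. With [3 n] samples the product is 3 * 58 / eta = 174 / eta. *)
have [|psi dp err3] := robust_to_private (g := 58 / (n%:R * eta)) _ err.
  by rewrite mulrAC ler_pdivlMr // ler_wpM2l // ltW // truncnS_gt.
split; first by rewrite addn_gt0 n_gt0.
have gs := gamma_star_le (divr_gt0 (ltr0Sn R 57) ne0) dp err3.
apply: le_trans (lee_wpmul2l _ gs) _; first by rewrite lee_fin.
rewrite -EFinM lee_fin !natrD le_eqVlt; apply/orP; left; apply/eqP.
by field; rewrite !lt0r_neq0.
Qed.

Lemma private_to_robust p q n k g (phi : test R X n) :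
  0 <= g -> g * k%:R <= 2^-1 -> is_DP g phi ->
  clean_prob p phi true + clean_prob q phi false <= 20^-1 ->
  (worst_error k p phi true + worst_error k q phi false <= (10^-1)%:E)%E.
Proof.
move=> g0 gk dp err.
apply: le_trans (leeD (worst_error_DP _ _ _ g0 dp) (worst_error_DP _ _ _ g0 dp)) _.
rewrite -EFinD lee_fin -mulrDr.
(* From [expR (- x) >= 1 - x >= 1/2] for [x <= 1/2]. *)
have e2 : expR (g * k%:R) <= 2.
  rewrite -[leLHS]invrK -expRN -[leRHS]invrK lef_pV2 ?posrE ?expR_gt0 //.
  by apply: le_trans (expR_ge1Dx _); lra.
have -> : 10^-1 = 2 * 20^-1 :> R by lra.
by apply: ler_pM; rewrite ?expR_ge0 ?addr_ge0 ?clean_prob_ge0.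
Qed.

Lemma n_robust_le_transformation p q eta : 0 < eta ->
  (n_robust p q eta <= 3%:E * N_transformation p q (eta / 12^-1))%E.
Proof.
move=> eta0; apply: least_le_mul => // n [n_gt0 gs].
have n0 : 0 < n%:R :> R by rewrite ltr0n.
have ne0 : 0 < n%:R * eta by rewrite mulr_gt0.
(* The hypothesis gives 1/12 in place of 1/6; the slack makes the bound strict, so an admissible
   privacy level lies below it. *)
have : (gamma_star p q n < (6^-1 / (n%:R * eta))%:E)%E.
  apply: (@le_lt_trans _ _ ((n%:R^-1)%:E * ((eta / 12^-1)^-1)%:E)%E).
    by rewrite -lee_pdivrMl ?invr_gt0 // (invrK n%:R); exact: gs.
  rewrite -EFinM lte_fin.
  have -> : n%:R^-1 * (eta / 12^-1)^-1 = 12^-1 / (n%:R * eta).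
    by field; rewrite !lt0r_neq0.
  by rewrite ltr_pM2r ?invr_gt0 //; lra.
move=> /ereal_inf_lt[_ [g [g0 priv] <-]]; rewrite lte_fin => g_lt.
have [m err mn] := least_leP priv; exists (m + (m + m))%N; last first.
  by rewrite -natrM ler_nat; lia.
(* Relaxing 1/10 to 1/9 extracts an actual test from the infimum; after the vote its error is at
   most 3/81 = 1/27, below 1/20. *)
have : (DP_error p q m g < (9^-1)%:E)%E.
  by apply: le_lt_trans err _; rewrite lte_fin; lra.
move=> /ereal_inf_lt[_ [phi dp <-]]; rewrite lte_fin => /ltW err9.
have [psi dpsi errpsi] := majority_test_error dp err9.
exists psi; apply: (private_to_robust (ltW g0)) dpsi _; last first.
  by apply: le_trans errpsi _; lra.
(* As [m <= n], the number of corruptions is at most [3 * (n%:R * eta)], and 3/6 = 1/2 is the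
   allowed group privacy loss. *)
apply: (@le_trans _ _ (6^-1 / (n%:R * eta) * (3 * (n%:R * eta)))); last first.
  by rewrite mulrCA divfK ?lt0r_neq0 //; lra.
apply: ler_pM; [exact: ltW|exact: ler0n|exact: ltW|].
apply: (@le_trans _ _ ((m + (m + m))%:R * eta)).
  by rewrite truncn_le mulr_ge0 ?ler0n ?ltW.
by rewrite mulrA (ler_wpM2r (ltW eta0)) // -natrM ler_nat; lia.
Qed.

End Comparison.

Theorem corollary8p5 (R : realType) :
  exists C1 C2 C3 c0 K : R,
    [/\ 0 < C2, C2 < C1, 0 < C3, 0 < c0 & 0 < K] /\
    forall (X : finType) (p q : distr R X) (eta : R),
      0 < eta -> eta <= c0 * dTV p q ->
      (N_transformation p q (eta / (C1 * C3)) <= K%:E * n_robust p q eta)%E /\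
      (n_robust p q eta <= K%:E * N_transformation p q (eta / C2))%E.
Proof.
(* [K = 3] counts the blocks of the vote; 174 and 1/12 are the constants of the two comparisons. *)
exists 1, 12^-1, 174, 1, 3; split; first by split; lra.
move=> X p q eta eta0 _; split; last exact: n_robust_le_transformation.
by rewrite mul1r; exact: N_transformation_le_robust.
Qed.
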